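(* Let $G$ be a finite group and let $S$ be a subset of $G$. Suppose that the Cayley sum graph $C_\Sigma(G,S)$ is undirected and connected. Assume that $S$ is symmetric. Then the cop number of $C_\Sigma(G,S)$ is at most $2|S|$.
   Context: A subset $S$ of a group $G$ is symmetric if $S=S^{-1}$, where $S^{-1}=\{s^{-1}: s\in S\}$. The Cayley sum graph $C_\Sigma(G,S)$ has the elements of $G$ as vertices, and there is an edge from a vertex $u$ to a vertex $v$ if $v=u^{-1}s$ for some $s\in S$ (loops may occur). Such a graph is undirected if its edge relation is symmetric, i.e. whenever there is an edge from $u$ to $v$ there is also an edge from $v$ to $u$. The game of cops and robbers on a finite connected graph is played as follows, with all positions visible to both sides. First, each of the cops chooses a vertex (several cops may occupy the same vertex); then the robber chooses a vertex. The cops and the robber then alternate turns, the cops going first; on a turn, players move along edges of the graph. In the cops' turn each cop may move along an edge or stay in place. It is assumed that the robber moves along some edge in each of its turns (a loop counts as an edge); the robber may not stay idle. The robber is captured when a cop and the robber occupy the same vertex. The cop number of the graph is the minimum number of cops required to capture the robber (after finitely many turns) no matter how the robber plays. *)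

(* Defs.v *)
From mathcomp Require Import all_boot all_fingroup.
From mathcomp Require Import boolp.

Set Implicit Arguments.
Unset Strict Implicit.
Unset Printing Implicit Defensive.

Import GroupScope.

Section CopsAndRobbers.

Variables (T : finType) (e : rel T).

Definition graph_connected : Prop := forall u v : T, connect e u v.

Section FixedNumberOfCops.

Variable k : nat.

Definition captured (c : {ffun 'I_k -> T}) (r : T) : bool :=
  [exists i, c i == r].

Definition cops_move (c c' : {ffun 'I_k -> T}) : bool :=
  [forall i, (c' i == c i) || e (c i) (c' i)].

(* [cops_win_from c r]: with the cops at [c], the robber at [r] and the cops to
   move, the cops can force a capture in finitely many turns.  The robber must
   follow an edge, so a robber at a vertex with no outgoing edge has no legal
   continuation and loses. *)
Inductive cops_win_from (c : {ffun 'I_k -> T}) (r : T) : Prop :=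
| CopsWinCaptured : captured c r -> cops_win_from c r
| CopsWinCatch c' : cops_move c c' -> captured c' r -> cops_win_from c r
| CopsWinRound c' : cops_move c c' ->
    (forall r', e r r' -> cops_win_from c' r') -> cops_win_from c r.

Definition cops_win : Prop :=
  exists c : {ffun 'I_k -> T}, forall r : T, cops_win_from c r.

End FixedNumberOfCops.

Lemma cops_win_exists : exists k, `[< cops_win k >].
Proof.
exists #|T|; apply/asboolP; exists [ffun i => enum_val i] => r.
apply: CopsWinCaptured; apply/existsP; exists (enum_rank r).
by rewrite ffunE enum_rankK.
Qed.

Definition cop_number : nat := ex_minn cops_win_exists.

End CopsAndRobbers.

Definition cayley_sum (gT : finGroupType) (S : {set gT}) : rel gT :=
  fun u v => [exists s in S, v == u^-1 * s].

(* Main.v *)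
(** Undirectedness makes [S] invariant under conjugation.  Replacing every second
    position of each player by its inverse turns the game into one on the Cayley
    graph of [S], where every mover multiplies on the right by an element of [S].
    Let [H] be the subgroup generated by [S * S].  By connectedness [H] has index
    at most two, so with one team of [#|S|] cops in each coset of [H], one team has
    all its quotients (robber)^-1 (cop) in [H].  Label the cops of that team by the
    elements of [S].  For each [s] in [S], [H] is generated by the elements
    [u^-1 * s] with [u] in [S], so the quotient of the cop labelled [s] is a word in
    those.  When the robber plays [s], that cop answers with a conjugate of [u] and
    erases the first letter [u^-1 * s] of its word; all the other cops of the team
    answer with a conjugate of [s] and keep their words.  The total length of the
    words decreases at each robber's move, so some cop ends with the empty word,
    that is, on the robber. *)
Require Import Defs.
From mathcomp Require Import all_boot all_fingroup.
From mathcomp Require Import boolp.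

Set Implicit Arguments.
Unset Strict Implicit.
Unset Printing Implicit Defensive.

Import GroupScope.

Lemma cop_number_le (T : finType) (e : rel T) k :
  cops_win e k -> (cop_number e <= k)%N.
Proof.
by move=> win_k; rewrite /cop_number; case: ex_minnP => m _; apply; apply/asboolP.
Qed.

Lemma cayley_sumE (gT : finGroupType) (S : {set gT}) u v :
  cayley_sum S u v = (u * v \in S).
Proof.
apply/existsP/idP => [[s /andP[sS /eqP->]]|uvS]; first by rewrite mulKVg.
by exists (u * v); rewrite uvS mulKg eqxx.
Qed.

(** The boolean is the parity of the round: it tells whether actual positions are the inverses of
    those in the untwisted game. *)
Definition flip (gT : finGroupType) (b : bool) (x : gT) := if b then x^-1 else x.

Lemma flipK (gT : finGroupType) b : involutive (@flip gT b).
Proof. by case: b => x //=; rewrite invgK. Qed.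

Definition word_prod (gT : finGroupType) (s : gT) (w : seq gT) :=
  \prod_(u <- w) (u^-1 * s).

Lemma word_prod_cons (gT : finGroupType) (s u : gT) w :
  word_prod s (u :: w) = u^-1 * s * word_prod s w.
Proof. exact: big_cons. Qed.

Section SymmetricUndirected.

Variables (gT : finGroupType) (S : {set gT}).
Hypotheses (S_undirected : symmetric (cayley_sum S)) (S_symmetric : S = S^-1).

Lemma memV_symmetric x : (x^-1 \in S) = (x \in S).
Proof. by rewrite {1}S_symmetric inE invgK. Qed.

Lemma memJ_undirected x g : (x ^ g \in S) = (x \in S).
Proof. by rewrite conjgE -cayley_sumE S_undirected cayley_sumE mulgK. Qed.

Lemma cayley_sum_flip b x y :
  cayley_sum S (flip b x) (flip (~~ b) y) = (x^-1 * y \in S).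
Proof.
case: b; rewrite cayley_sumE //= -memV_symmetric invMg invgK.
by rewrite -cayley_sumE S_undirected cayley_sumE.
Qed.

(** In a finite group generators suffice without inverses, so it is enough to split [a * b] as
    [a * s] times [s^-1 * b]: the letter [a^-1] gives the first factor, the letter [b] the inverse
    of the second. *)
Lemma mem_gen_word s x : s \in S -> x \in <<S * S>> ->
  exists2 w, all (mem S) w & x = word_prod s w.
Proof.
move=> sS xH; pose A := [set u^-1 * s | u in S].
have AP u : u \in S -> u^-1 * s \in <<A>>.
  by move=> uS; apply/mem_gen/imset_f.
have subA : <<S * S>> \subset <<A>>.
  rewrite gen_subG; apply/subsetP=> _ /mulsgP[a b aS bS ->].
  rewrite -(mulKVg s b) mulgA groupM //.
    by rewrite -[a]invgK AP ?memV_symmetric.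
  by rewrite -[b]invgK -invMg groupV AP ?memV_symmetric.
have /gen_prodgP[n [c cA ->]] := subsetP subA x xH.
pose f i := s * (c i)^-1.
exists [seq f i | i <- index_enum 'I_n].
  apply/allP=> _ /mapP[i _ ->] /=; rewrite /f.
  by have /imsetP[u uS ->] := cA i; rewrite invMg invgK mulKVg.
rewrite /word_prod big_map; apply: eq_bigr => i _.
by rewrite /f invMg invgK mulgKV.
Qed.

(** An edge from [y] to [z] has [y * z] in [S], so it leads from either alternative to the other,
    once normality of [H] turns [y * s] into [s * y]. Hence [K] is closed under edges, and it
    contains 1. *)
Lemma cayley_sum_two_cosets s x : graph_connected (cayley_sum S) -> s \in S ->
  (x \in <<S * S>>) || (x * s \in <<S * S>>).
Proof.
move=> S_connected sS; set H := <<_>>.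
have nS : [set: gT] \subset 'N(S).
  by apply/subsetP=> y _; rewrite inE; apply/subsetP=> _ /imsetP[z zS ->];
     rewrite memJ_undirected.
have nH y h : (h ^ y \in H) = (h \in H).
  apply: memJ_norm; apply: (subsetP (norms_gen (normsM nS nS))); exact: in_setT.
have SS a b : a \in S -> b \in S -> a * b \in H.
  by move=> aS bS; apply/mem_gen/mem_mulg.
pose K := [pred y | (y \in H) || (y * s \in H)].
have clK : closed (cayley_sum S) K.
  apply: intro_closed => [|y z]; first exact: sym_connect_sym.
  rewrite cayley_sumE !inE => yzS /orP[yH|ysH]; apply/orP.
    by right; rewrite -(groupMl _ yH) mulgA SS.
  have syH : s * y \in H by rewrite -(nH s) conjgE -mulgA mulKg.
  by left; rewrite -(groupMl _ syH) -mulgA SS.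
by have := closed_connect clK (S_connected x 1); rewrite !inE group1.
Qed.

Section Team.

Variables (k : nat) (label : 'I_k -> gT) (team : {pred 'I_k}).
Hypothesis team_covers : forall s, s \in S -> exists2 i, i \in team & label i = s.

(** The words measure the cops against [R], where the robber stood before the still unanswered move
    to [r]. *)
Lemma team_wins n b (C : 'I_k -> gT) (R : gT) (W : 'I_k -> seq gT) r :
    (forall i, i \in team ->
       all (mem S) (W i) /\ C i = R * word_prod (label i) (W i)) ->
    (\sum_(i in team) size (W i) < n)%N -> cayley_sum S (flip b R) r ->
  cops_win_from (cayley_sum S) [ffun i => flip b (C i)] r.
Proof.
elim: n b C R W r => // n IHn b C R W r CW ltWn.
rewrite -(flipK (~~ b) r); move: (flip _ r) => R'; rewrite cayley_sum_flip.
set s := R^-1 * R' => sS.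
have def_R' : R' = R * s by rewrite mulKVg.
pose W' i := if label i == s then behead (W i) else W i.
(* The inverse cancels the change of parity, so a cop outside the team stays in place. *)
pose C' i := if i \in team then R' * word_prod (label i) (W' i) else (C i)^-1.
pose c' := [ffun i => flip (~~ b) (C' i)].
have mv : cops_move (cayley_sum S) [ffun i => flip b (C i)] c'.
  apply/forallP=> i; rewrite !ffunE /C'.
  case: ifP => [iA|_]; last by case: (b); rewrite /= ?invgK eqxx.
  have [WS ->] := CW i iA; apply/orP; right; rewrite cayley_sum_flip def_R' /W'.
  have stay w : (R * word_prod (label i) w)^-1 * (R * s * word_prod (label i) w)
      = s ^ word_prod (label i) w.
    by rewrite invMg conjgE -!mulgA mulKg.
  case: eqP => [eq_s|_]; last by rewrite stay memJ_undirected.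
  case: (W i) WS => [_|u w /= /andP[uS _]]; first by rewrite stay memJ_undirected.
  (* Putting the erased letter back shows that the cop moved by a conjugate of [u]. *)
  suff -> : R * s * word_prod (label i) w = R * u * word_prod (label i) (u :: w).
    by rewrite invMg -!mulgA mulKg -conjgE memJ_undirected.
  by rewrite word_prod_cons eq_s !mulgA mulgK.
have [j jA lj] := team_covers sS.
(* With an empty word this very answer lands on the robber. *)
case Wj: (W j) => [|u w].
  apply: (CopsWinCatch mv); apply/existsP; exists j.
  by rewrite ffunE /C' jA /W' lj eqxx Wj /word_prod big_nil mulg1.
apply: (CopsWinRound mv) => r'; apply: (IHn _ _ _ W') => [i iA|].
  rewrite /C' iA; split=> //; have [WS _] := CW i iA.
  by rewrite /W'; case: ifP => // _; case: (W i) WS => //= ? ? /andP[].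
rewrite -ltnS; apply: leq_trans ltWn; rewrite !ltnS.
rewrite (bigD1 j jA) [leqRHS](bigD1 j jA) /= {1}/W' lj eqxx Wj /= ltnS.
apply: leq_add => //; apply: leq_sum => i _.
by rewrite /W'; case: ifP => // _; rewrite size_behead leq_pred.
Qed.

End Team.

Lemma cops_win_two_teams : graph_connected (cayley_sum S) ->
  cops_win (cayley_sum S) (#|S| + #|S|).
Proof.
move=> S_connected; have [S0|[s0 s0S]] := set_0Vmem S.
  (* Without edges the robber has no legal move. *)
  exists [ffun=> 1] => r; apply: (CopsWinRound (c' := [ffun=> 1])) => [|r'].
    by apply/forallP=> i; rewrite eqxx.
  by rewrite cayley_sumE => rS; have := in_set0 (r * r'); rewrite -S0 rS.
(* These are untwisted positions: the second team actually stands at [s0]. *)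
pose start (i : 'I_#|S| + 'I_#|S|) : gT := if i is inl _ then 1 else s0^-1.
pose label (i : 'I_(#|S| + #|S|)) : gT :=
  match split i with inl j | inr j => enum_val j end.
exists [ffun i => flip true (start (split i))] => r.
(* The robber is treated as having just arrived at [r] by playing [s0]. *)
pose R := r * s0^-1.
pose team : {pred 'I_(#|S| + #|S|)} :=
  [pred i | R^-1 * start (split i) \in <<S * S>>].
have covers s : s \in S -> exists2 i, i \in team & label i = s.
  move=> sS; pose j : 'I_#|S| := enum_rank_in sS s.
  have lj : enum_val j = s by rewrite enum_rankK_in.
  have s0V : s0^-1 \in S by rewrite memV_symmetric.
  case/orP: (cayley_sum_two_cosets R^-1 S_connected s0V) => RH.
    exists (unsplit (inl j)); last by rewrite /label unsplitK.
    by rewrite unfold_in unsplitK /= mulg1.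
  exists (unsplit (inr j)); last by rewrite /label unsplitK.
  by rewrite unfold_in unsplitK.
have label_in i : label i \in S.
  by rewrite /label; case: split => j; apply: enum_valP.
have words i : exists w, i \in team ->
    all (mem S) w /\ start (split i) = R * word_prod (label i) w.
  case: (boolP (i \in team)) => [iA|_]; last by exists [::].
  have [w wS def_w] := mem_gen_word (label_in i) iA.
  by exists w => _; split; rewrite // -def_w mulKVg.
have [W WP] := choice words.
apply: (team_wins covers WP (ltnSn _)).
by rewrite cayley_sumE /= /R invMg invgK mulgKV.
Qed.

End SymmetricUndirected.

Theorem theorem1p1 (gT : finGroupType) (S : {set gT})
    (S_undirected : symmetric (cayley_sum S))
    (S_connected : graph_connected (cayley_sum S))
    (S_symmetric : S = (S^-1)%g) :
  (cop_number (cayley_sum S) <= 2 * #|S|)%N.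
Proof.
rewrite mul2n -addnn; apply: cop_number_le.
exact: cops_win_two_teams.
Qed.
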